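(* Let $A$ be an alphabet of size $\sigma \ge 5$. Then for all sufficiently large $n$ the expected length of the maximal unbordered factor of a uniformly random string of length $n$ over $A$ is at least $0.99\,n$; that is, for each $\sigma\ge 5$ there is $n_0$ such that for all $n \ge n_0$, $$\frac{1}{\sigma^n}\sum_{S\in A^n} b(S) \ge 0.99\, n .$$
   Context: $A^n$ is the set of all strings of length $n$ over the finite alphabet $A$, and expectations are taken with respect to the uniform distribution on $A^n$. A factor of a string $S=S[1]\cdots S[n]$ is a contiguous substring $S[i..j]=S[i]\cdots S[j]$, $1\le i\le j\le n$. A prefix or suffix of $S$ is proper if it is non-empty and different from $S$. A border of a string is a proper prefix of it that is simultaneously a suffix of it. A string is unbordered if it has no border (in particular every string of length 1 is unbordered). The maximal unbordered factor of $S$ is a longest factor of $S$ that is unbordered; $b(S)$ denotes its length. *)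

(* Defs.v *)
From HB Require Import structures.
From mathcomp Require Import all_boot all_order all_algebra.
Set Implicit Arguments.
Unset Strict Implicit.
Unset Printing Implicit Defensive.

(* Positions are 0-based, so [factor s i j] is S[i+1..j+1]; it is meant to be
   used with i <= j < size s. *)
Definition factor (T : Type) (s : seq T) (i j : nat) : seq T :=
  take (j.+1 - i) (drop i s).

Definition is_border (T : eqType) (u s : seq T) : bool :=
  [&& u != [::], u != s, prefix u s & suffix u s].

(* Only the prefixes [take k s] of [s] can be borders of [s], so it suffices
   to test these; [unborderedP] is the defining property. *)
Definition unbordered (T : eqType) (s : seq T) : bool :=
  all (fun k => ~~ is_border (take k s) s) (iota 0 (size s).+1).

Lemma unborderedP (T : eqType) (s : seq T) :
  reflect (~ exists u, is_border u s) (unbordered s).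
Proof.
apply: (iffP allP) => [nb [u bu] | nb k _]; last first.
  by apply/negP => bk; apply: nb; exists (take k s).
have /and4P[_ _ pu _] := bu; move: (pu); rewrite prefixE => /eqP us.
have:= nb (size u); rewrite mem_iota /= add0n ltnS size_prefix // us bu.
by move/(_ isT).
Qed.

(* The value is 0 only when [s] is empty, since strings of length 1 are
   unbordered. *)
Definition max_unbordered (T : eqType) (s : seq T) : nat :=
  \max_(i < size s) \max_(j < size s | (i <= j) && unbordered (factor s i j))
    size (factor s i j).

(* Main.v *)
(** Fix k and L and look at the k prefixes of S of lengths n, n - L, ...,
    n - (k - 1) L. Given the first L letters of S, the k blocks of length L in
    which these prefixes end are independent, and each prefix has a border of
    length at most L with probability at most 1/5 + 1/5^2 + ... = 1/4; so all
    of them do with probability at most 4^-k. A bordered string has a border of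
    at most half its length, and a given prefix has such a border longer than L
    with probability at most 5^-L / 4. For k = L = 4, outside an event of
    probability 1/256 + 1/625 < 0.006 one of the prefixes is unbordered, and
    its length is at least n - 16. *)

Require Import Defs.
From HB Require Import structures.
From mathcomp Require Import all_boot all_order all_algebra.
From mathcomp Require Import zify lra.
Set Implicit Arguments.
Unset Strict Implicit.
Unset Printing Implicit Defensive.
Import Order.TTheory GRing.Theory Num.Theory.
Local Open Scope ring_scope.

(** * Borders as equalities between shifted letters *)

(* For [l <= m <= size s]: the prefix of [s] of length [m] has its own prefix of
   length [l] as a suffix. *)
Definition border_at (T : eqType) (m l : nat) (s : seq T) : bool :=
  take l s == take l (drop (m - l) s).

Lemma border_atP (T : eqType) (x0 : T) (m l : nat) (s : seq T) :
  (l <= m)%N -> (m <= size s)%N ->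
  reflect (forall i, (i < l)%N -> nth x0 s i = nth x0 s (m - l + i))
    (border_at m l s).
Proof.
move=> lm ms; apply: (iffP eqP) => [E i il | E].
  by rewrite -(nth_take _ il) E nth_take // nth_drop.
have sz1 : size (take l s) = l by rewrite size_takel //; lia.
apply: (@eq_from_nth _ x0).
  by rewrite sz1 size_takel // size_drop; lia.
by move=> i; rewrite sz1 => il; rewrite !nth_take // nth_drop E.
Qed.

(* A border longer than half of the string overlaps itself, and the overlap
   is a shorter border. *)
Lemma border_at_half (T : eqType) (x0 : T) (m l : nat) (s : seq T) :
  (0 < l < m)%N -> (m <= size s)%N -> border_at m l s ->
  exists l', [/\ (0 < l')%N, (l'.*2 <= m)%N & border_at m l' s].
Proof.
elim/ltn_ind: l => l IH /andP[l0 lm] ms bl.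
have [h|h] := leqP l.*2 m; first by exists l.
apply: (IH (l.*2 - m)%N) => //; [by lia | by lia |].
have H := elimT (border_atP x0 (ltnW lm) ms) bl.
apply/(border_atP x0) => //; first by lia.
(* For [i < 2 l - m] the shift by [m - l] can be applied twice, and [2 (m - l) = m - (2 l - m)]. *)
move=> i il; rewrite H; last by lia.
rewrite H; last by lia.
by congr nth; lia.
Qed.

Lemma bordered_half (T : eqType) (x0 : T) (m : nat) (s : seq T) :
  (m <= size s)%N -> ~~ unbordered (take m s) ->
  exists l, [/\ (0 < l)%N, (l.*2 <= m)%N & border_at m l s].
Proof.
move=> ms /allPn[l _]; rewrite negbK => /and4P[u0 us pu su].
have szm : size (take m s) = m by rewrite size_takel.
set u := take l (take m s) in u0 us pu su *.
have pu' := pu; rewrite prefixE in pu'; move/eqP in pu'.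
have su' := su; rewrite suffixE in su'; move/eqP in su'.
have um : (size u <= m)%N by rewrite -szm size_prefix.
have um' : (size u < m)%N.
  rewrite ltn_neqAle um andbT; apply/eqP => e; move/eqP: us; apply.
  by rewrite -[LHS]pu' take_oversize // szm e.
apply: (@border_at_half _ x0 m (size u)) => //.
  by rewrite um' andbT lt0n size_eq0.
apply/(border_atP x0) => // i iu.
have e1 : nth x0 u i = nth x0 s i.
  by rewrite -pu' !nth_take //; lia.
by rewrite -e1 -[in LHS]su' szm nth_drop nth_take //; lia.
Qed.

Lemma max_unbordered_ge (T : eqType) (m : nat) (s : seq T) :
  (0 < m <= size s)%N -> unbordered (take m s) -> (m <= max_unbordered s)%N.
Proof.
move=> /andP[m0 ms] um.
have h0 : (0 < size s)%N by lia.
have hm : (m.-1 < size s)%N by lia.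
have E : factor s 0 m.-1 = take m s by rewrite /factor drop0 subn0 prednK.
apply: leq_trans (leq_bigmax (Ordinal h0)).
apply: (@leq_trans (size (factor s (Ordinal h0) (Ordinal hm)))).
  by rewrite /= E size_takel.
by apply: leq_bigmax_cond; rewrite /= E.
Qed.

(** * Counting strings whose prefixes are bordered *)

Section Counting.
Variables (A : finType) (n : nat).
Implicit Types (W : {set n.-tuple A}) (S : n.-tuple A).

(* Overwriting the [l] letters that end at position [m] by arbitrary ones is
   injective on the strings satisfying [border_at m l]: the overwritten letters
   can be recovered from the prefix. *)
Lemma card_border_at (m l : nat) W :
  (l.*2 <= m <= n)%N ->
  (forall S S', take (m - l) S = take (m - l) S' -> drop m S = drop m S' ->
     S \in W -> S' \in W) ->
  (#|[set S in W | border_at m l S]| * #|A| ^ l <= #|W|)%N.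
Proof.
move=> /andP[lm mn] HW.
pose g (p : n.-tuple A * l.-tuple A) : n.-tuple A :=
  insubd p.1 (take (m - l) p.1 ++ p.2 ++ drop m p.1).
(* The three lengths add up to [n], so the default of [insubd] is never taken. *)
have vg p : g p = take (m - l) p.1 ++ p.2 ++ drop m p.1 :> seq A.
  rewrite /g val_insubd !size_cat size_drop size_takel !size_tuple; last by lia.
  by case: eqP => //; lia.
have tg p : take (m - l) (g p) = take (m - l) p.1.
  by rewrite vg take_cat size_takel ?size_tuple ?ltnn ?subnn ?take0 ?cats0 //; lia.
have dg p : drop (m - l) (g p) = p.2 ++ drop m p.1.
  by rewrite vg drop_cat size_takel ?size_tuple ?ltnn ?subnn ?drop0 //; lia.
have dmg p : drop m (g p) = drop m p.1.
  have -> : m = (l + (m - l))%N by lia.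
  rewrite -drop_drop dg drop_cat size_tuple ltnn subnn drop0.
  by congr drop; lia.
rewrite -(card_tuple l A) -[X in (_ * X)%N]cardsT -cardsX -(@card_in_imset _ _ g).
  apply/subset_leq_card/subsetP => _ /imsetP[[S c] /setXP[hS _] ->].
  by move: hS; rewrite inE => /andP[+ _]; apply: HW; rewrite (tg, dmg).
move=> [S c] [S' c'] /setXP[hS _] /setXP[hS' _].
move: hS hS'; rewrite !inE => /andP[_ b] /andP[_ b'] E.
have Et := tg (S, c); rewrite E tg /= in Et.
have Ed := dg (S, c); rewrite E dg /= in Ed.
have Em := dmg (S, c); rewrite E dmg /= in Em.
(* Since [2 l <= m], the first [l] letters lie in the part that [g] keeps. *)
have tl (R : n.-tuple A) : take l R = take l (take (m - l) R).
  by rewrite take_takel //; lia.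
have dec (R : n.-tuple A) : border_at m l R ->
    R = take (m - l) R ++ take l (take (m - l) R) ++ drop m R :> seq A.
  move=> /eqP bR; rewrite -tl bR.
  rewrite -{1}(cat_take_drop (m - l) R); congr cat.
  rewrite -{1}(cat_take_drop l (drop (m - l) R)) drop_drop; congr cat.
  by congr drop; lia.
congr pair; last first.
  apply: val_inj => /=.
  by move/(congr1 (take l)): Ed; rewrite !take_cat !size_tuple ltnn subnn !take0 !cats0.
by apply: val_inj; rewrite /= (dec S) // (dec S') // Et Em.
Qed.

(* The strings whose prefixes of lengths [n], [n - L], ..., [n - (k - 1) L]
   all have a border of length at most [L]. *)
Fixpoint short_bordered (L k : nat) : {set n.-tuple A} :=
  if k is k'.+1 then
    [set S in short_bordered L k' |
       [exists l : 'I_L, border_at (n - k' * L) l.+1 S]]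
  else setT.

(** Each border test compares letters among the first [L] with letters from position [n - k * L] on.
    Overwriting letters in between thus preserves membership, which replaces independence in
    [card_short_bordered]. *)
Lemma short_bordered_local (L k : nat) S S' :
  take L S = take L S' -> drop (n - k * L) S = drop (n - k * L) S' ->
  S \in short_bordered L k -> S' \in short_bordered L k.
Proof.
move=> tE; elim: k => [|k IH] dE; first by rewrite !inE.
have dE' i : (n - k.+1 * L <= i)%N -> drop i S = drop i S'.
  by move=> h; rewrite -(subnK h) -!drop_drop dE.
rewrite !inE => /andP[/IH-> /=]; last by apply: dE'; rewrite leq_sub2l // mulSn leq_addl.
move=> /existsP[l /eqP bl]; apply/existsP; exists l; apply/eqP.
have lL := ltn_ord l.
rewrite -(take_takel _ lL) -tE take_takel // bl dE' //.
by rewrite mulSn addnC subnDA leq_sub2l.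
Qed.

Local Notation q := (#|A|%:R : rat).
Local Notation N := (q ^+ n).

Lemma card_border_at_rat (m l : nat) W :
  (0 < #|A|)%N -> (l.*2 <= m <= n)%N ->
  (forall S S', take (m - l) S = take (m - l) S' -> drop m S = drop m S' ->
     S \in W -> S' \in W) ->
  #|[set S in W | border_at m l S]|%:R <= #|W|%:R * q^-1 ^+ l.
Proof.
move=> A0 lm HW; rewrite exprVn ler_pdivlMr ?exprn_gt0 ?ltr0n //.
by rewrite -natrX -natrM ler_nat card_border_at.
Qed.

(** Splitting off the first term leaves [x * (1 + t)] with [t <= 1/4], and
    [1/5 * (1 + 1/4) = 1/4]. *)
Lemma sum_geometric_le (x : rat) (k : nat) :
  0 <= x <= 1 / 5 -> \sum_(i < k) x ^+ i.+1 <= 1 / 4.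
Proof.
move=> /andP[x0 x1]; elim: k => [|k IH]; first by rewrite big_ord0.
rewrite big_ord_recl expr1.
under eq_bigr do rewrite lift0 exprS.
by rewrite -mulr_sumr; nra.
Qed.

Lemma card_bigcup_le (I : finType) (P : pred I) (F : I -> {set n.-tuple A}) :
  #|\bigcup_(i | P i) F i|%:R <= \sum_(i | P i) (#|F i|%:R : rat).
Proof.
rewrite -natr_sum ler_nat.
elim/big_rec2: _ => [|i y B _ IH]; first by rewrite cards0.
by apply: leq_trans (leq_card_setU _ _) _; rewrite leq_add2l.
Qed.

Hypothesis hA : (5 <= #|A|)%N.

Let qV : 0 <= q^-1 <= 1 / 5.
Proof.
have A0 : 0 < q by rewrite ltr0n (leq_trans _ hA).
by rewrite invr_ge0 ltW //= div1r lef_pV2 ?posrE // (ler_nat _ 5).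
Qed.

Lemma card_short_bordered (L k : nat) :
  (k.+1 * L <= n)%N ->
  #|short_bordered L k|%:R <= N * (1 / 4) ^+ k.
Proof.
elim: k => [|k IH] hk; first by rewrite mulr1 /= cardsT card_tuple natrX.
have /IH {}IH : (k.+1 * L <= n)%N by apply: leq_trans hk; rewrite leq_mul2r leqnSn orbT.
rewrite exprS mulrCA; apply: (@le_trans _ _ (1 / 4 * #|short_bordered L k|%:R)); last first.
  by rewrite ler_wpM2l.
apply: (@le_trans _ _ (\sum_(l < L)
    #|[set S in short_bordered L k | border_at (n - k * L) l.+1 S]|%:R)).
  rewrite -(big_mkcond xpredT) /=.
  apply: le_trans (card_bigcup_le _ _); rewrite ler_nat.
  apply/subset_leq_card/subsetP => S; rewrite inE => /andP[SW /existsP[l bl]].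
  by apply/bigcupP; exists l => //; rewrite inE SW.
apply: (@le_trans _ _ (\sum_(l < L) #|short_bordered L k|%:R * q^-1 ^+ l.+1)).
  apply: ler_sum => l _; have lL := ltn_ord l.
  apply: card_border_at_rat; [by lia | by rewrite !mulSn in hk; lia |].
  move=> S S' tE dE; apply: short_bordered_local => //.
  (* Here [n - k * L] is at least [2 * L], so the overwritten block avoids the first [L] letters. *)
  have Lm : (L <= n - k * L - l.+1)%N by rewrite !mulSn in hk; lia.
  by rewrite -(take_takel _ Lm) tE take_takel.
by rewrite -mulr_sumr mulrC ler_wpM2r ?ler0n // sum_geometric_le.
Qed.

(** The cap at half of [m] is provided by [bordered_half] and required by [card_border_at]. *)
Definition long_bordered (L m : nat) : {set n.-tuple A} :=
  \bigcup_(l < n | ((L + l.+1).*2 <= m)%N)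
    [set S : n.-tuple A | border_at m (L + l.+1) S].

Lemma card_long_bordered (L m : nat) :
  (m <= n)%N -> #|long_bordered L m|%:R <= N * ((1 / 5) ^+ L / 4).
Proof.
move=> mn; apply: le_trans (card_bigcup_le _ _) _.
have N0 : 0 <= N by rewrite exprn_ge0.
have /andP[qV0 qV5] := qV.
apply: (@le_trans _ _ (\sum_(l < n) N * q^-1 ^+ L * q^-1 ^+ l.+1)).
  rewrite big_mkcond; apply: ler_sum => l _.
  case: ifP => h; last by rewrite !mulr_ge0 ?exprn_ge0.
  have -> : [set S : n.-tuple A | border_at m (L + l.+1) S]
          = [set S : n.-tuple A in setT | border_at m (L + l.+1) S].
    by apply/setP => S; rewrite !inE.
  rewrite -mulrA -exprD -natrX -card_tuple -[#|{: n.-tuple A}|]cardsT.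
  by apply: card_border_at_rat => //; [lia | rewrite h].
rewrite -mulr_sumr -mulrA ler_wpM2l // ler_pM ?exprn_ge0 ?sumr_ge0 //.
- by move=> i _; rewrite exprn_ge0.
- by rewrite lerXn2r ?nnegrE.
- by rewrite -[4^-1]div1r sum_geometric_le.
Qed.

(** Pick for each prefix a border of at most half its length: either one of them is longer than [L],
    or all are short. *)
Lemma all_bordered_cover (L k : nat) S :
  (forall j, (j < k)%N -> ~~ unbordered (take (n - j * L) S)) ->
  S \in short_bordered L k :|: \bigcup_(j < k) long_bordered L (n - j * L).
Proof.
elim: k => [|k IH] H; first by rewrite !inE.
rewrite big_ord_recr /= setUA in_setU.
have [//|nl] := boolP (S \in long_bordered _ _); first by rewrite orbT.
have : S \in short_bordered L k :|: \bigcup_(j < k) long_bordered L (n - j * L).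
  by apply: IH => j jk; apply: H; rewrite ltnS ltnW.
rewrite !in_setU orbF => /orP[sS|->]; last by rewrite orbT.
have x0 : A by have /card_gt0P/sigW[] : (0 < #|A|)%N by lia.
have sn : (n - k * L <= size S)%N by rewrite size_tuple leq_subr.
have [l [l0 lm bl]] := bordered_half x0 sn (H k (ltnSn k)).
rewrite inE sS /=; apply/orP; left; apply/existsP.
have [lL|Ll] := leqP l L.
  have hl : (l.-1 < L)%N by lia.
  by exists (Ordinal hl); rewrite /= prednK.
case/negP: nl; have hl : (l - L.+1 < n)%N by lia.
have e : (L + (l - L.+1).+1)%N = l by lia.
by apply/bigcupP; exists (Ordinal hl); rewrite /= ?inE e.
Qed.

(** * From the counts to the expectation *)

Lemma card_unbordered_prefix (L k : nat) :
  (k.+1 * L <= n)%N ->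
  N * (1 - (1 / 4) ^+ k - k%:R * ((1 / 5) ^+ L / 4)) <=
  #|[set S : n.-tuple A | [exists j : 'I_k, unbordered (take (n - j * L) S)]]|%:R.
Proof.
move=> hk; set G := [set S | _].
pose B := short_bordered L k :|: \bigcup_(j < k) long_bordered L (n - j * L).
have GB : ~: G \subset B.
  apply/subsetP => S; rewrite !inE negb_exists => /forallP H.
  have := @all_bordered_cover L k S; rewrite /B in_setU; apply.
  by move=> j jk; apply: (H (Ordinal jk)).
have cG : #|G|%:R + #|~: G|%:R = N :> rat.
  by rewrite -natrD cardsC card_tuple natrX.
have cGB : #|~: G|%:R <= #|B|%:R :> rat by rewrite ler_nat subset_leq_card.
have cB : #|B|%:R <= #|short_bordered L k|%:R
        + #|\bigcup_(j < k) long_bordered L (n - j * L)|%:R :> rat.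
  by rewrite -natrD ler_nat leq_card_setU.
have cS := card_short_bordered hk.
have cL : #|\bigcup_(j < k) long_bordered L (n - j * L)|%:R
        <= k%:R * (N * ((1 / 5) ^+ L / 4)).
  apply: le_trans (card_bigcup_le _ _) _.
  rewrite -[k in k%:R]card_ord mulr_natl -sumr_const.
  by apply: ler_sum => j _; apply: card_long_bordered; rewrite leq_subr.
by lra.
Qed.

Lemma sum_max_unbordered_ge (k L : nat) :
  (k.+1 * L <= n)%N -> (0 < L)%N ->
  N * (1 - (1 / 4) ^+ k - k%:R * ((1 / 5) ^+ L / 4)) * (n%:R - (k * L)%:R) <=
  \sum_(S : n.-tuple A) (max_unbordered S)%:R.
Proof.
move=> hk L0; have := card_unbordered_prefix hk.
set G := [set S | _] => cG; have kLn : (k * L < n)%N by rewrite mulSn in hk; lia.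
apply: (@le_trans _ _ (\sum_(S in G) (n - k * L)%:R)).
  by rewrite sumr_const -[leRHS]mulr_natl natrB ?ler_wpM2r ?subr_ge0 ?ler_nat // ltnW.
rewrite [leRHS](bigID (mem G)) /= -[leLHS]addr0 lerD ?sumr_ge0 //.
apply: ler_sum => S; rewrite inE => /existsP[j uj]; rewrite ler_nat.
have jk : (j * L <= k * L)%N by rewrite leq_mul2r ltnW ?orbT.
apply: leq_trans (max_unbordered_ge _ uj); first exact: leq_sub2l.
by rewrite size_tuple; lia.
Qed.

End Counting.

Theorem corollary3 (sigma : nat) (hsigma : (5 <= sigma)%N) :
  exists n0 : nat,
    forall A : finType, #|A| = sigma ->
    forall n : nat, (n0 <= n)%N ->
      99%:R / 100%:R * n%:R <=
        (\sum_(S : n.-tuple A) (max_unbordered S)%:R) / sigma%:R ^+ n :> rat.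
Proof.
(* For [k = L = 4] the good fraction is [1 - 1/256 - 1/625 > 0.994], and
   [0.994 * (n - 16) >= 0.99 * n] once [n >= 3976]. *)
exists 4000%N => A cA n hn; rewrite -cA in hsigma *.
have N0 : 0 < (#|A|%:R : rat) ^+ n.
  (* With [hn] in the context, [//] may try to unify it with the goal by
     computing with the unary 4000. *)
  by clear hn; rewrite exprn_gt0 // ltr0n (leq_trans _ hsigma).
have hk : (5 * 4 <= n)%N by apply: leq_trans hn.
have E := sum_max_unbordered_ge hsigma hk isT.
rewrite (ler_pdivlMr _ _ N0); apply: le_trans E.
rewrite [leLHS]mulrC -[leRHS]mulrA (ler_pM2l N0).
have [x xE] : exists x : rat, x = n%:R by exists n%:R.
have hx : 4000 <= x by rewrite xE (ler_nat _ 4000).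
by rewrite -xE; clear hn xE; lra.
Qed.
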